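(* For all $\alpha\ge 0$ and $c>0$, the Logitron loss function $L_{\alpha,c}:\mathbb{R}\to[0,\infty)$ is classification-calibrated.
   Context: For $\alpha\ge 0$, $c>0$, and (when $\alpha\neq 1$) $c_\alpha=\frac{c^{1-\alpha}}{\alpha-1}$: Extended logarithm: $\ln_{1,c}(u)=\ln(u/c)$, and $\ln_{\alpha,c}(u)=\frac{1}{1-\alpha}(u^{1-\alpha}-c^{1-\alpha})$ for $\alpha\ne1$, with domain $\mathrm{dom}(\ln_{\alpha,c})=(0,\infty)$ if $\alpha\ge 1$ and $[0,\infty)$ if $0\le\alpha<1$. Extended exponential: $\exp_{1,c}(v)=c\exp(v)$, and $\exp_{\alpha,c}(v)=(c^{1-\alpha}+(1-\alpha)v)^{1/(1-\alpha)}$ for $\alpha\neq 1$, with domain $\mathrm{dom}(\exp_{\alpha,c})=\mathbb{R}$ if $\alpha=1$, $[c_\alpha,\infty)$ if $0\le\alpha<1$, and $(-\infty,c_\alpha)$ if $\alpha>1$. Extended logistic loss: $\ell_{\alpha,c}(z)=\ln_{\alpha,c}(c+\exp_{\alpha,c}(-z))$ for $z\in\mathrm{dom}(\ell_{\alpha,c})=\{z\in\mathbb{R}: -z\in\mathrm{dom}(\exp_{\alpha,c})\}$. Perceptron loss: $\ell_P(z)=\max(0,-z)$. Logitron loss: $L_{\alpha,c}(z)=\ell_{\alpha,c}(z)$ if $z\in\mathrm{dom}(\ell_{\alpha,c})$, and $L_{\alpha,c}(z)=\ell_P(z)$ otherwise. Classification calibration (in the sense of Bartlett, Jordan and McAuliffe):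 a function $\phi:\mathbb{R}\to[0,\infty)$ is classification-calibrated if for every $\eta\in[0,1]$ with $\eta\ne\frac12$, $$\inf_{z\in\mathbb{R}:\, z(2\eta-1)\le 0}\big(\eta\phi(z)+(1-\eta)\phi(-z)\big)>\inf_{z\in\mathbb{R}}\big(\eta\phi(z)+(1-\eta)\phi(-z)\big).$$ *)

(* Defs.v *)
From mathcomp Require Import all_boot all_order all_algebra.
From mathcomp Require Import all_classical all_reals all_analysis.

Set Implicit Arguments.
Unset Strict Implicit.
Unset Printing Implicit Defensive.

Import Order.TTheory GRing.Theory Num.Theory.

Local Open Scope classical_set_scope.
Local Open Scope ring_scope.

Section logitron.
Context {R : realType}.
Implicit Types (alpha c u v z : R).

(* Only used for alpha != 1; at alpha = 1 the value is a junk 0. *)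
Definition c_alpha alpha c : R := c `^ (1 - alpha) / (alpha - 1).

(* Totalised: meaningful for u in [0, +oo[ if alpha < 1, u > 0 otherwise. *)
Definition ext_ln alpha c u : R :=
  if alpha == 1 then ln (u / c)
  else (1 - alpha)^-1 * (u `^ (1 - alpha) - c `^ (1 - alpha)).

Definition dom_ext_exp alpha c : interval R :=
  if alpha == 1 then `]-oo, +oo[
  else if alpha < 1 then `[c_alpha alpha c, +oo[
  else `]-oo, c_alpha alpha c[.

(* Totalised: meaningful for v in dom_ext_exp alpha c, where the base of the
   power is nonnegative (positive if alpha > 1). *)
Definition ext_exp alpha c v : R :=
  if alpha == 1 then c * expR v
  else (c `^ (1 - alpha) + (1 - alpha) * v) `^ (1 - alpha)^-1.

(* For c > 0 the argument of ext_ln is positive, hence in its domain. *)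
Definition ext_logistic alpha c z : R :=
  ext_ln alpha c (c + ext_exp alpha c (- z)).

Definition perceptron z : R := Num.max 0 (- z).

Definition logitron alpha c z : R :=
  if - z \in dom_ext_exp alpha c then ext_logistic alpha c z
  else perceptron z.

Definition cond_risk (phi : R -> R) (eta z : R) : R :=
  eta * phi z + (1 - eta) * phi (- z).

(* Calibration in the sense of Bartlett, Jordan and McAuliffe, for phi with
   values in [0, +oo[: both sets are then nonempty and bounded below, so that
   inf is the genuine infimum. *)
Definition classification_calibrated (phi : R -> R) : Prop :=
  (forall z : R, 0 <= phi z) /\
  forall eta : R, 0 <= eta <= 1 -> eta != 2^-1 ->
    inf [set cond_risk phi eta z | z in [set z : R | z * (2 * eta - 1) <= 0]] >
    inf [set cond_risk phi eta z | z in [set: R]].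

End logitron.

(* Main.v *)
Require Import Defs.
From mathcomp Require Import all_boot all_order all_algebra.
From mathcomp Require Import all_classical all_reals all_analysis.
From mathcomp Require Import ring lra.

Set Implicit Arguments.
Unset Strict Implicit.
Unset Printing Implicit Defensive.

Import Order.TTheory GRing.Theory Num.Theory.
Import numFieldNormedType.Exports.

Local Open Scope ring_scope.

(* Put s = 2^(-alpha). The loss L has derivative -s at 0 and lies above its
   tangent there: L z >= L 0 - s z for every z. Hence the conditional risk is at
   least L 0 on the half-line z (2 eta - 1) <= 0, while its derivative at 0 is
   - s (2 eta - 1) <> 0, so 0 is not a global minimum and some point has a risk
   below L 0. For alpha <> 1 put p = 1 - alpha and w = exp_{alpha,c}(-z), so that
   z = (c^p - w^p) / p; the tangent inequality is then midpoint concavity of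
   x^p / p at c and w. For alpha = 1 it is AM-GM for 1 and exp (- z). *)

(** * Tangent criterion for calibration *)

(** The difference quotient at [a] is nonpositive on the left and nonnegative on the right, so its
    limit can be neither positive nor negative. *)
Lemma is_derive_min_eq0 {R : realType} (f : R -> R) (a d : R) :
  is_derive a 1 f d -> (forall t, f a <= f t) -> d = 0.
Proof.
move=> fd fmin.
have cv : (h^-1 * (f (h + a) - f a) @[h --> 0^'] --> d)%classic.
  have [/cvg_ex[l /= fl] <-] := fd.
  rewrite /derive (cvg_lim _ fl)//.
  apply: cvg_trans fl; apply: near_eq_cvg; near=> h.
  by rewrite /= /GRing.scale/= mulr1.
apply/eqP; rewrite eq_le; apply/andP; split; rewrite leNgt; apply/negP => dN.
- have cl := cvg_dnbhs_at_left cv.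
  near ((0 : R)^'-)%classic => h.
  have : 0 < h^-1 * (f (h + a) - f a) by near: h; exact: cvgr_gt cl _ dN.
  by rewrite ltNge mulr_le0_ge0 ?subr_ge0// invr_le0.
- have cr := cvg_dnbhs_at_right cv.
  near ((0 : R)^'+)%classic => h.
  have : h^-1 * (f (h + a) - f a) < 0 by near: h; exact: cvgr_lt cr _ dN.
  by rewrite ltNge mulr_ge0 ?subr_ge0// invr_ge0.
Unshelve. all: by end_near. Qed.

Lemma tangent_classification_calibrated {R : realType} (phi : R -> R) (s : R) :
  (forall z, 0 <= phi z) -> 0 < s -> is_derive (0 : R) 1 phi (- s) ->
  (forall z, phi 0 - s * z <= phi z) ->
  classification_calibrated phi.
Proof.
move=> phi0 s0 dphi tan; split=> // eta /andP[eta0 eta1] etaN.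
(* Weighting the tangent bounds at [z] and [- z] by [eta] and [1 - eta] leaves
   [phi 0 - s * (z * (2 * eta - 1))]. *)
have half z : z * (2 * eta - 1) <= 0 -> phi 0 <= cond_risk phi eta z.
  have := tan z; have := tan (- z); rewrite /cond_risk => h1 h2 h3.
  have e0 : 0 <= 1 - eta by lra.
  have := ler_wpM2l eta0 h2; have := ler_wpM2l e0 h1.
  have : s * (z * (2 * eta - 1)) <= 0 by rewrite mulr_ge0_le0// ltW.
  lra.
have [t tlt] : exists t, cond_risk phi eta t < phi 0.
  apply: contrapT => /forallNP no.
  have C0 : cond_risk phi eta 0 = phi 0 by rewrite /cond_risk oppr0; ring.
  have dC : is_derive (0 : R) 1 (cond_risk phi eta) (eta * - s + (1 - eta) * s).
    have dN : is_derive (0 : R) 1 (fun z : R => phi (- z)) s.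
      have dphi' : is_derive (- (0 : R)) 1 phi (- s) by rewrite oppr0.
      have := is_derive1_comp dphi' (is_deriveN (is_derive_id (0 : R) 1)).
      by rewrite mulrN1 opprK.
    exact: is_deriveD (is_deriveZ eta dphi) (is_deriveZ (1 - eta) dN).
  have /eqP : eta * - s + (1 - eta) * s = 0.
    apply: is_derive_min_eq0 dC _ => t; rewrite C0 leNgt.
    by apply/negP; exact: no.
  have -> : eta * - s + (1 - eta) * s = - 2 * s * (eta - 2^-1) by field.
  rewrite !mulf_eq0 subr_eq0 (negbTE etaN) (gt_eqF s0) !orbF oppr_eq0.
  by rewrite pnatr_eq0.
apply: (@le_lt_trans _ _ (cond_risk phi eta t)).
  apply: ge_inf; last by exists t.
  exists 0 => _ [z _ <-]; rewrite /cond_risk.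
  by rewrite addr_ge0// mulr_ge0// subr_ge0.
apply: (lt_le_trans tlt); apply: lb_le_inf.
  by exists (cond_risk phi eta 0); exists 0 => //=; rewrite mul0r.
by move=> _ [z /= zle <-]; exact: half.
Qed.

(** * Concavity of x^p / p *)

(** The right side is the tangent at [u = 1] of the concave function u^p / p; keeping the factor
    [p^-1] gives one inequality for both signs of [p]. *)
Lemma powR_bernoulli {R : realType} (p u : R) : p != 0 -> p <= 1 -> 0 < u ->
  p^-1 * u `^ p <= p^-1 + u - 1.
Proof.
move=> p0 p1 u0.
have lnle x : 0 < x -> ln x <= x - 1.
  by move=> x0; rewrite -{1}(subrKC 1 x) le_ln1Dx//; lra.
have upE : u `^ p = expR (p * ln u) by rewrite /powR gt_eqF.
have [p_gt0|p_lt0|pE] := ltgtP 0 p; last by rewrite -pE eqxx in p0.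
  have m0 : 0 < p * u + (1 - p).
    by rewrite ltr_pwDl ?subr_ge0// mulr_gt0.
  have h : u `^ p <= p * u + (1 - p).
    (* The bound ln x <= x - 1 is used at [u / m] and [m^-1] with weights [p] and [1 - p]; since [m]
       is the same weighted mean of [u] and 1, the right sides cancel. *)
    set m := p * u + (1 - p) in m0 *.
    rewrite -[leRHS]lnK ?posrE// upE ler_expR.
    have h1 : ln u - ln m <= u / m - 1.
      by rewrite -ln_div ?posrE//; apply: lnle; rewrite divr_gt0.
    have h2 : - ln m <= m^-1 - 1.
      by rewrite -lnV ?posrE//; apply: lnle; rewrite invr_gt0.
    have q0 : 0 <= 1 - p by rewrite subr_ge0.
    have := ler_wpM2l (ltW p_gt0) h1; have := ler_wpM2l q0 h2.
    have : p * (u / m - 1) + (1 - p) * (m^-1 - 1) = 0.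
      by rewrite /m; field; rewrite gt_eqF.
    lra.
  have pV : 0 <= p^-1 by rewrite invr_ge0 ltW.
  have := ler_wpM2l pV h.
  by have -> : p^-1 * (p * u + (1 - p)) = p^-1 + u - 1 by field.
have h : 1 + p * (u - 1) <= u `^ p.
  (* Multiplying by the negative [p] reverses ln u <= u - 1. *)
  rewrite upE; apply: le_trans (expR_ge1Dx _).
  by rewrite lerD2l ler_wnM2l ?lnle// ltW.
have pV : p^-1 <= 0 by rewrite invr_le0 ltW.
have := ler_wnM2l pV h.
by have -> : p^-1 * (1 + p * (u - 1)) = p^-1 + u - 1 by field.
Qed.

(** Both points are compared with the tangent at their midpoint [m]: divided by [m] they sum to 2,
    so the linear terms cancel. *)
Lemma powR_midpoint_concave {R : realType} (p x y : R) : p != 0 -> p <= 1 ->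
  0 < x -> 0 < y ->
  p^-1 * (2 `^ p / 2 * (x `^ p + y `^ p)) <= p^-1 * (x + y) `^ p.
Proof.
move=> p0 p1 x0 y0.
pose m := (x + y) / 2.
have m0 : 0 < m by rewrite divr_gt0// addr_gt0.
have hx := powR_bernoulli p0 p1 (divr_gt0 x0 m0).
have hy := powR_bernoulli p0 p1 (divr_gt0 y0 m0).
have E z : 0 < z -> z `^ p = (z / m) `^ p * m `^ p.
  move=> z0; have zm0 : 0 < z / m by exact: divr_gt0.
  by rewrite -(powRM p (ltW zm0) (ltW m0)) divfK// gt_eqF.
have -> : x + y = 2 * m by rewrite /m; field.
rewrite (powRM p _ (ltW m0))// (E x)// (E y)//.
have sum2 : x / m + y / m = 2.
  by rewrite -mulrDl /m; field; rewrite gt_eqF// addr_gt0.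
have K0 : 0 <= 2 `^ p / 2 * m `^ p :> R.
  by rewrite mulr_ge0 ?powR_ge0// divr_ge0 ?powR_ge0.
have hxy : p^-1 * (x / m) `^ p + p^-1 * (y / m) `^ p <= 2 * p^-1 by lra.
have := ler_wpM2l K0 hxy.
lra.
Qed.

(** * The case alpha <> 1 *)

Section power_case.
Context {R : realType} (alpha c : R).
Hypotheses (alpha_ge0 : 0 <= alpha) (c_gt0 : 0 < c) (alphaN1 : alpha != 1).

Let p := 1 - alpha.
Let k := c `^ p.

Let p_neq0 : p != 0. Proof. by rewrite subr_eq0 eq_sym. Qed.
Let p_le1 : p <= 1. Proof. by rewrite gerBl. Qed.
Let k_gt0 : 0 < k. Proof. exact: powR_gt0. Qed.

(* If alpha < 1, the endpoint z = k / p of the domain falls in the second branch: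
   both formulas give 0 there. *)
Lemma logitron_powE z : logitron alpha c z =
  if 0 < k + p * - z then p^-1 * ((c + (k + p * - z) `^ p^-1) `^ p - k)
  else perceptron z.
Proof.
rewrite /logitron /dom_ext_exp /ext_logistic /ext_ln /ext_exp (negbTE alphaN1).
rewrite /c_alpha -/p -/k.
have kE : k / (alpha - 1) = - (k / p).
  by rewrite /p; field; rewrite !subr_eq0 alphaN1 eq_sym alphaN1.
have [alt1|agt1|aE] := ltgtP alpha 1; last by have := alphaN1; rewrite aE eqxx.
- have p_gt0 : 0 < p by rewrite subr_gt0.
  rewrite in_itv/= andbT kE lerN2 ler_pdivlMr//.
  have -> : (0 < k + p * - z) = (z * p < k) by apply/idP/idP; lra.
  rewrite le_eqVlt; have [zE|] := eqVneq (z * p) k => //=.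
  have -> : k + p * - z = 0 by rewrite -zE; ring.
  rewrite zE ltxx powR0 ?invr_eq0// addr0 subrr mulr0 /perceptron.
  rewrite max_l// oppr_le0.
  by rewrite -(pmulr_lge0 _ p_gt0) zE ltW.
- have p_lt0 : p < 0 by rewrite subr_lt0.
  rewrite in_itv/= kE ltrN2 ltr_ndivrMr//.
  by have -> : (0 < k + p * - z) = (z * p < k) by apply/idP/idP; lra.
Qed.

(** On the domain, c + w > c and x^p / p is increasing for either sign of [p]. *)
Lemma logitron_pow_ge0 z : 0 <= logitron alpha c z.
Proof.
rewrite logitron_powE; case: ifP => [B0|_]; last first.
  by rewrite /perceptron le_max lexx.
set w := _ `^ p^-1; have w0 : 0 < w by exact: powR_gt0.
have [p_gt0|p_lt0|pE] := ltgtP 0 p; last by have := p_neq0; rewrite -pE eqxx.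
  apply: mulr_ge0; first by rewrite invr_ge0 ltW.
  rewrite subr_ge0; apply: ge0_ler_powR; rewrite ?nnegrE ?ltW//.
  - exact: addr_gt0.
  - by rewrite ltrDl.
apply: mulr_le0; first by rewrite invr_le0 ltW.
rewrite subr_le0 /k -[p]opprK !(powRN _ (- p)).
rewrite lef_pV2 ?posrE ?powR_gt0 ?addr_gt0//.
apply: ge0_ler_powR; rewrite ?nnegrE ?oppr_ge0 ?ltW//.
- exact: addr_gt0.
- by rewrite ltrDl.
Qed.

Lemma logitron_pow0 : logitron alpha c 0 = p^-1 * ((2 `^ p - 1) * k).
Proof.
rewrite logitron_powE oppr0 mulr0 addr0 k_gt0.
rewrite /k -powRrM mulfV// powRr1 ?ltW//.
have -> : c + c = 2 * c by ring.
by rewrite powRM// ?ltW//; ring.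
Qed.

Lemma logitron_pow_tangent z :
  logitron alpha c 0 - 2 `^ p / 2 * z <= logitron alpha c z.
Proof.
rewrite logitron_pow0 logitron_powE; set t := 2 `^ p.
have t0 : 0 < t by exact: powR_gt0.
case: ifPn => [B0|].
  set w := _ `^ p^-1; have w0 : 0 < w by exact: powR_gt0.
  have wE : w `^ p = k + p * - z by rewrite /w -powRrM mulVf// powRr1// ltW.
  have := powR_midpoint_concave p_neq0 p_le1 c_gt0 w0.
  rewrite -/k -/t wE.
  have -> : p^-1 * (t / 2 * (k + (k + p * - z))) = p^-1 * t * k - t / 2 * z.
    by field.
  lra.
rewrite -leNgt => B0.
(* [b] is the endpoint of the domain in [z], where [k - p * z] vanishes. *)
pose b := p^-1 * k.
have kE : k = p * b by rewrite /b; field.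
have -> : p^-1 * ((t - 1) * k) = (t - 1) * b by rewrite /b; ring.
have pB : p * (b - z) <= 0 by rewrite mulrBr -kE; lra.
have [p_gt0|p_lt0|pE] := ltgtP 0 p; last by have := p_neq0; rewrite -pE eqxx.
  (* Since t - 1 <= t / 2, the tangent is at most [t / 2 * (b - z)], hence nonpositive, while the
     perceptron loss is 0. *)
  have t2 : t <= 2 by rewrite /t -[leRHS]powRr1// ler_powR// ler1n.
  have b0 : 0 < b by rewrite mulr_gt0// invr_gt0.
  have zb : b <= z by rewrite -subr_le0 -(pmulr_rle0 _ p_gt0).
  rewrite /perceptron max_l; last lra.
  nra.
(* Here the loss is [- z]; the claim follows from 0 <= 1 - t <= 1 - t / 2 and 0 < - b <= - z by
   multiplication. *)
have t1 : t <= 1 by rewrite /t -[leRHS](powRr0 2) ler_powR// ?ler1n// ltW.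
have b0 : b < 0 by rewrite nmulr_rlt0// invr_lt0.
have zb : z <= b by rewrite -subr_ge0 -(nmulr_rle0 _ p_lt0).
rewrite /perceptron max_r; last lra.
nra.
Qed.

(** Chain rule through [A], the power [p^-1] shifted by [c], and the power [p]; the values at 0 are
    [k] and then [2 * c]. *)
Lemma logitron_pow_is_derive0 :
  is_derive (0 : R) 1 (logitron alpha c) (- (2 `^ p / 2)).
Proof.
pose A := fun z : R => k + p * - z.
have A0 : A 0 = k by rewrite /A oppr0 mulr0 addr0.
have dA : is_derive (0 : R) 1 A (- p).
  have d1 := is_deriveN (is_derive_id (0 : R) 1).
  have d2 := is_deriveD (is_derive_cst k (0 : R) 1) (is_deriveZ p d1).
  by apply: (is_derive_eq d2); rewrite add0r scalerN [_ *: _]mulr1.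
have dB : is_derive (A 0) 1 (fun x : R => x `^ p^-1) (p^-1 * c `^ (1 - p)).
  rewrite A0; have := is_derive1_powR p^-1 k_gt0.
  by rewrite {2}/k -powRrM mulrBr mulr1 mulfV.
have dAB := is_derive1_comp dB dA.
have dC := is_deriveD (is_derive_cst c (0:R) 1) dAB.
rewrite add0r in dC.
set g := (_ + _) in dC.
have g0 : g 0 = 2 * c.
  rewrite /g /= /GRing.add /= A0 /k -powRrM mulfV// powRr1 ?ltW//; ring.
have g0_gt0 : 0 < g 0 by rewrite g0 mulr_gt0.
have dD := is_derive1_comp (is_derive1_powR p g0_gt0) dC.
have dE := is_deriveZ p^-1 (is_deriveB dD (is_derive_cst k (0:R) 1)).
(* [A] is continuous and positive at 0, so the loss agrees with its first branch near 0. *)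
apply: (@near_eq_is_derive _ _ _
  (fun z => p^-1 * ((c + (k + p * - z) `^ p^-1) `^ p - k))).
  near=> z; rewrite logitron_powE ifT//.
  near: z.
  have cA : {for (0 : R), continuous A}.
    by apply: differentiable_continuous; apply/derivable1_diffP; case: dA.
  by apply: (cvgr_gt _ cA); rewrite A0.
move: dE; rewrite g0 => dE.
apply: (is_derive_eq dE).
rewrite powRM// ?ltW// subr0.
rewrite /GRing.scale/=.
(* The powers of [c] cancel, so the slope is independent of [c]. *)
have cc : c `^ (p - 1) * c `^ (1 - p) = 1.
  rewrite -powRD; last by rewrite (gt_eqF c_gt0) implybT.
  by rewrite (_ : p - 1 + (1 - p) = 0) ?powRr0//; ring.
have -> : 2 `^ (p - 1) = 2 `^ p / 2 :> R.
  by rewrite powRD ?pnatr_eq0 ?implybT// powR_inv1.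
transitivity (- (2 `^ p / 2) * (c `^ (p - 1) * c `^ (1 - p))); first by field.
by rewrite cc mulr1.
Unshelve. all: by end_near. Qed.

Lemma logitron_pow_calibrated : classification_calibrated (logitron alpha c).
Proof.
apply: (@tangent_classification_calibrated _ _ (2 `^ p / 2)).
- exact: logitron_pow_ge0.
- by rewrite divr_gt0// powR_gt0.
- exact: logitron_pow_is_derive0.
- exact: logitron_pow_tangent.
Qed.

End power_case.

(** * The case alpha = 1 *)

Lemma logitron1E {R : realType} (c z : R) : 0 < c ->
  logitron 1 c z = ln (1 + expR (- z)).
Proof.
move=> c0; rewrite /logitron /dom_ext_exp /ext_logistic /ext_ln /ext_exp eqxx.
rewrite in_itv/=; congr ln; field; exact: lt0r_neq0.
Qed.

Lemma logitron1_calibrated {R : realType} (c : R) : 0 < c ->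
  classification_calibrated (logitron 1 c).
Proof.
move=> c0.
have -> : logitron 1 c = fun z => ln (1 + expR (- z)).
  by apply/funext => z; rewrite logitron1E.
have e0 (z : R) : 0 < 1 + expR (- z) by rewrite addr_gt0// expR_gt0.
apply: (@tangent_classification_calibrated _ _ 2^-1).
- by move=> z; rewrite ln_ge0// lerDl expR_ge0.
- by rewrite invr_gt0.
- have dN := is_deriveN (is_derive_id (0:R) 1).
  have dE := is_derive1_comp (is_derive_expR (- (0:R))) dN.
  have dS := is_deriveD (is_derive_cst (1:R) (0:R) 1) dE.
  set g := (_ + _) in dS.
  have gE : g 0 = 2 by rewrite /g /GRing.add/= oppr0 expR0.
  have g0 : 0 < g 0 by rewrite gE.
  apply: (is_derive_eq (is_derive1_comp (is_derive1_ln g0) dS)).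
  by rewrite gE oppr0 expR0; field.
- move=> z; rewrite oppr0 expR0.
  have hE : expR (- z) = expR (- (z / 2)) ^+ 2.
    by rewrite expr2 -expRD; congr expR; field.
  (* The tangent is the logarithm of 2 exp(- z / 2), so the claim becomes (exp(- z / 2) - 1)^2 >=
     0. *)
  rewrite -[X in _ - X]expRK -ln_div ?posrE ?expR_gt0// -expRN.
  rewrite ler_ln ?posrE ?mulr_gt0 ?expR_gt0//.
  rewrite hE (mulrC 2^-1).
  have := sqr_ge0 (expR (- (z / 2)) - 1); nra.
Qed.

Theorem mainTheorem2 (R : realType) (alpha c : R)
    (halpha : 0 <= alpha) (hc : 0 < c) :
  classification_calibrated (logitron alpha c).
Proof.
have [->|alphaN1] := eqVneq alpha 1; first exact: logitron1_calibrated.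
exact: logitron_pow_calibrated.
Qed.
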